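(* Let $\varphi: (R,\mathfrak m)\to (S,\mathfrak n)$ be a flat local homomorphism between commutative Noetherian local rings, and assume that $\ell_R(S/\mathfrak mS)=m$ is finite. Let $A$ be an Artinian $R$-module. Then $A^m$ has a structure of Artinian $S$-module such that there is an isomorphism $A\otimes_R S\cong A^m$ of $S$-modules, and such that, if this $S$-module $A^m$ is regarded as an $R$-module by means of $\varphi$, then the usual $R$-module structure on $A^m$ is recovered.
   Context: $\ell_R(-)$ denotes length as an $R$-module, where $S/\mathfrak mS$ is an $R$-module by means of $\varphi$. The $S$-module structure on $A\otimes_R S$ is the one given by multiplication on the second factor. The usual $R$-module structure on $A^m$ is $r(a_1,\ldots,a_m)=(ra_1,\ldots,ra_m)$ for $r\in R$, $(a_1,\ldots,a_m)\in A^m$. *)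

(* Defs.v *)
From HB Require Import structures.
From mathcomp Require Import all_boot all_algebra.
From mathcomp Require Import generic_quotient ring_quotient.
From mathcomp Require Import boolp classical_sets.
From mathcomp.multinomials Require Import freeg.

Set Implicit Arguments.
Unset Strict Implicit.
Unset Printing Implicit Defensive.

Import GRing.Theory.

Local Open Scope classical_set_scope.
Local Open Scope ring_scope.
Local Open Scope quotient_scope.

Section Submodules.
Variables (R : comNzRingType) (M : lmodType R).

Definition is_submod (N : set M) : Prop :=
  N 0 /\ forall (a : R) (u v : M), N u -> N v -> N (a *: u + v).

Record submodule := Submodule {
  submod_set :> set M;
  submodP : is_submod submod_set }.

Lemma span_is_submod (G : set M) : is_submod (smallest is_submod G).
Proof.
split=> [N [[N0 _] _] //|a u v Gu Gv N NG].
by have [[_ NS] _] := NG; apply: NS; [exact: Gu | exact: Gv].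
Qed.

Definition span (G : set M) : submodule := Submodule (span_is_submod G).

Lemma sub_span (G : set M) : G `<=` span G.
Proof. by move=> x Gx N [_]; apply. Qed.

Lemma span_min (G : set M) (N : submodule) : G `<=` N -> span G `<=` N.
Proof. by move=> GN x; apply; split=> //; exact: submodP. Qed.

Definition noetherian : Prop :=
  forall N : nat -> submodule, (forall i, N i `<=` N i.+1) ->
  exists n, forall i, (n <= i)%N -> N i = N n :> set M.

Definition artinian : Prop :=
  forall N : nat -> submodule, (forall i, N i.+1 `<=` N i) ->
  exists n, forall i, (n <= i)%N -> N i = N n :> set M.

(* N 0, ..., N n; the values of N beyond n are irrelevant. *)
Definition strict_chain (n : nat) (N : nat -> submodule) : Prop :=
  forall i, (i < n)%N -> N i `<` N i.+1.

(* Length as the largest n such that there is a chain of submodules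
   N_0 < N_1 < ... < N_n, so [has_length n] includes that it is finite. *)
Definition has_length (n : nat) : Prop :=
  (exists N, strict_chain n N) /\
  forall k N, strict_chain k N -> (k <= n)%N.

End Submodules.

Notation ideal R := (submodule R^o).

Section LocalRings.
Variable R : comNzRingType.

Definition maximal_ideal (I : ideal R) : Prop :=
  I <> [set: R] :> set R /\
  forall J : ideal R, I `<=` J -> J = I :> set R \/ J = [set: R] :> set R.

Definition local_ring (I : ideal R) : Prop :=
  maximal_ideal I /\
  forall J : ideal R, maximal_ideal J -> J = I :> set R.

End LocalRings.

Section QuotientModule.
Variables (R : comNzRingType) (M : lmodType R) (N : submodule M).

Definition submod_pred : {pred M} := fun x => `[< submod_set N x >].

Lemma submod_predP x : reflect (submod_set N x) (x \in submod_pred).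
Proof. exact: asboolP. Qed.

Lemma submod_pred_zmod : zmod_closed submod_pred.
Proof.
have [N0 NS] := submodP N; split; first exact/submod_predP.
move=> x y /submod_predP Nx /submod_predP Ny; apply/submod_predP.
by rewrite addrC -scaleN1r; apply: NS.
Qed.

HB.instance Definition _ :=
  GRing.isZmodClosed.Build M submod_pred submod_pred_zmod.

Definition quotmod : Type := Quotient.quot submod_pred.

HB.instance Definition _ := GRing.Zmodule.on quotmod.

Definition qpi (x : M) : quotmod := \pi_(Quotient.quot submod_pred) x.

Definition qrepr (x : quotmod) : M := repr (x : (Quotient.quot submod_pred)).

Lemma qreprK x : qpi (qrepr x) = x. Proof. exact: reprK. Qed.

Lemma qpi_is_zmod_morphism : zmod_morphism qpi.
Proof. by move=> x y; rewrite /qpi raddfB. Qed.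

HB.instance Definition _ :=
  GRing.isZmodMorphism.Build M quotmod qpi qpi_is_zmod_morphism.

Lemma qpi_eq x y : qpi x = qpi y <-> submod_set N (x - y).
Proof.
split=> [/eqP|Nxy]; last apply/eqP;
  rewrite /qpi -(Quotient.idealrBE submod_pred) //; first by move/submod_predP.
exact/submod_predP.
Qed.

Lemma qpi_eq0 x : qpi x = 0 <-> submod_set N x.
Proof. by rewrite -(raddf0 qpi) qpi_eq subr0. Qed.

Definition qscale (a : R) (x : quotmod) : quotmod := qpi (a *: qrepr x).

Lemma qscale_qpi a x : qscale a (qpi x) = qpi (a *: x).
Proof.
apply/qpi_eq; rewrite -scalerBr -[_ *: _]addr0.
have [N0 NS] := submodP N; apply: NS => //.
by apply/qpi_eq; rewrite qreprK.
Qed.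

Lemma qscaleA a b x : qscale a (qscale b x) = qscale (a * b) x.
Proof. by rewrite -[x]qreprK !qscale_qpi scalerA. Qed.

Lemma qscale1 : left_id 1 qscale.
Proof. by move=> x; rewrite -[x]qreprK qscale_qpi scale1r. Qed.

Lemma qscaleDr : right_distributive qscale +%R.
Proof.
move=> a x y; rewrite -[x]qreprK -[y]qreprK -raddfD !qscale_qpi.
by rewrite -raddfD scalerDr.
Qed.

Lemma qscaleDl x : {morph qscale^~ x : a b / a + b}.
Proof. by move=> a b /=; rewrite -[x]qreprK !qscale_qpi -raddfD scalerDl. Qed.

HB.instance Definition _ := GRing.Zmodule_isLmodule.Build R quotmod
  qscaleA qscale1 qscaleDr qscaleDl.

Lemma qpi_is_scalable : scalable qpi.
Proof. by move=> a x; rewrite [RHS]qscale_qpi. Qed.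

HB.instance Definition _ :=
  GRing.isScalable.Build R M quotmod *:%R qpi qpi_is_scalable.

End QuotientModule.

(* An alias of M carrying the R-module structure induced through phi. *)
Definition restr (R S : comNzRingType) (phi : {rmorphism R -> S}) (M : Type) :
  Type := M.

Section RestrictionOfScalars.
Variables (R S : comNzRingType) (phi : {rmorphism R -> S}) (M : lmodType S).

HB.instance Definition _ := GRing.Zmodule.on (restr phi M).

Definition restr_scale (r : R) (x : restr phi M) : restr phi M := phi r *: (x : M).

Lemma restr_scaleA a b x :
  restr_scale a (restr_scale b x) = restr_scale (a * b) x.
Proof. by rewrite /restr_scale scalerA rmorphM. Qed.

Lemma restr_scale1 : left_id 1 restr_scale.
Proof. by move=> x; rewrite /restr_scale rmorph1 scale1r. Qed.

Lemma restr_scaleDr : right_distributive restr_scale +%R.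
Proof. by move=> a x y; rewrite /restr_scale scalerDr. Qed.

Lemma restr_scaleDl x : {morph restr_scale^~ x : a b / a + b}.
Proof. by move=> a b; rewrite /restr_scale rmorphD scalerDl. Qed.

HB.instance Definition _ := GRing.Zmodule_isLmodule.Build R (restr phi M)
  restr_scaleA restr_scale1 restr_scaleDr restr_scaleDl.

Definition restr_mul (s : S) (x : restr phi M) : restr phi M := s *: (x : M).

Lemma restr_mul_is_linear s : linear (restr_mul s).
Proof.
move=> a x y; rewrite /restr_mul scalerDr; congr (_ + _).
by rewrite [LHS]scalerA mulrC -scalerA.
Qed.

HB.instance Definition _ (s : S) :=
  GRing.isLinear.Build R (restr phi M) (restr phi M) *:%R (restr_mul s)
    (restr_mul_is_linear s).

End RestrictionOfScalars.

Section Tensor.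
Variable R : comNzRingType.

Section Def.
Variables M N : lmodType R.

(* {freeg (M * N) / R} is the free R-module on M * N; basis element (x, y). *)
Definition fgpair (x : M) (y : N) : {freeg (M * N) / R} := << (x, y) >>.

Inductive tensor_rel : set {freeg (M * N) / R} :=
| TensDl x x' y :
    tensor_rel (fgpair (x + x') y - fgpair x y - fgpair x' y)
| TensDr x y y' :
    tensor_rel (fgpair x (y + y') - fgpair x y - fgpair x y')
| TensZl a x y : tensor_rel (fgpair (a *: x) y - a *: fgpair x y)
| TensZr a x y : tensor_rel (fgpair x (a *: y) - a *: fgpair x y).

Definition tensor : Type := quotmod (span tensor_rel).

HB.instance Definition _ := GRing.Lmodule.on tensor.

Definition tens (x : M) (y : N) : tensor := qpi (span tensor_rel) (fgpair x y).

Lemma tensDl x x' y : tens (x + x') y = tens x y + tens x' y.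
Proof.
apply/eqP; rewrite -subr_eq0 opprD addrA -!raddfB; apply/eqP/qpi_eq0.
by apply: sub_span; exact: TensDl.
Qed.

Lemma tensDr x y y' : tens x (y + y') = tens x y + tens x y'.
Proof.
apply/eqP; rewrite -subr_eq0 opprD addrA -!raddfB; apply/eqP/qpi_eq0.
by apply: sub_span; exact: TensDr.
Qed.

Lemma tensZl a x y : tens (a *: x) y = a *: tens x y.
Proof.
by rewrite /tens -linearZ; apply/qpi_eq; apply: sub_span; exact: TensZl.
Qed.

Lemma tensZr a x y : tens x (a *: y) = a *: tens x y.
Proof.
by rewrite /tens -linearZ; apply/qpi_eq; apply: sub_span; exact: TensZr.
Qed.

Lemma tensE (t : tensor) :
  exists s : seq (M * N), t = \sum_(p <- s) tens p.1 p.2.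
Proof.
have [D ->] : exists D, t = qpi (span tensor_rel) D.
  by exists (qrepr t); rewrite qreprK.
exists [seq (coeff p D *: p.1, p.2) | p <- dom D].
rewrite -{1}[D]freeg_sumE raddf_sum [RHS]big_map /=; apply: eq_bigr => -[x y] _ /=; rewrite tensZl /tens -linearZ.
congr qpi; apply/eqP/freeg_eqP => z.
by rewrite coeffZ !coeffU mul1r.
Qed.

Section Lift.
Variables (P : lmodType R) (b : M -> N -> P).

Definition tensor_lift (t : tensor) : P :=
  fglift (fun p => b p.1 p.2) (qrepr t).

Hypothesis b_linl : forall y, linear (b^~ y).
Hypothesis b_linr : forall x, linear (b x).

Let bl : {freeg (M * N) / R} -> P := fglift (fun p => b p.1 p.2).

Lemma fglift_is_linear : linear bl.
Proof.
have blB : zmod_morphism bl by exact: lift_is_additive.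
pose h : {additive {freeg (M * N) / R} -> P} :=
  HB.pack bl (GRing.isZmodMorphism.Build _ _ bl blB).
move=> a D E; rewrite -[bl _]/(h _) raddfD; congr (_ + _).
have hZ z : h (a *: << coeff z D *g z >>) = a *: h << coeff z D *g z >>.
  have -> : a *: << coeff z D *g z >> = << a * coeff z D *g z >>.
    by apply/eqP/freeg_eqP => w; rewrite coeffZ !coeffU mulrA.
  by rewrite [LHS]liftU [h _]liftU scalerA.
suff hs s : h (a *: \sum_(z <- s) << coeff z D *g z >>) =
            a *: h (\sum_(z <- s) << coeff z D *g z >>).
  by rewrite -[RHS]/(a *: h D) -[D]freeg_sumE hs.
elim: s => [|z s IH]; first by rewrite big_nil scaler0 raddf0 scaler0.
by rewrite big_cons scalerDr (raddfD h) hZ IH (raddfD h) scalerDr.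
Qed.

Lemma fglift_tensor_rel D : submod_set (span tensor_rel) D -> bl D = 0.
Proof.
have blL := fglift_is_linear.
have blB : zmod_morphism bl by exact: lift_is_additive.
have bl0 : bl 0 = 0 by have := blB 0 0; rewrite !subrr.
have blZ a E : bl (a *: E) = a *: bl E.
  by have := blL a E 0; rewrite bl0 !addr0.
have blE x y : bl (fgpair x y) = b x y by rewrite [LHS]liftU scale1r.
have ker_submod : is_submod [set D | bl D = 0].
  by split=> [//|a u v hu hv]; rewrite /mkset blL [bl u]hu [bl v]hv scaler0 add0r.
have b_l y : zmod_morphism (b^~ y).
  by move=> x x'; rewrite addrC -scaleN1r b_linl scaleN1r addrC.
have b_r x : zmod_morphism (b x).
  by move=> y y'; rewrite addrC -scaleN1r b_linr scaleN1r addrC.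
apply: (@span_min _ _ _ (Submodule ker_submod)) => {}D.
case=> [x x' y|x y y'|a x y|a x y]; rewrite -[submod_set _ _]/(bl _ = 0);
  rewrite !blB ?blZ !blE.
- by have := b_linl y 1 x x'; rewrite !scale1r => ->; rewrite addrAC addrK subrr.
- by have := b_linr x 1 y y'; rewrite !scale1r => ->; rewrite addrAC addrK subrr.
- have := b_linl y a x 0; rewrite addr0 => ->.
  by have := b_l y 0 0; rewrite !subrr => ->; rewrite addr0 subrr.
- have := b_linr x a y 0; rewrite addr0 => ->.
  by have := b_r x 0 0; rewrite !subrr => ->; rewrite addr0 subrr.
Qed.

Lemma tensor_lift_qpi D : tensor_lift (qpi (span tensor_rel) D) = bl D.
Proof.
have blB : zmod_morphism bl by exact: lift_is_additive.
apply/eqP; rewrite -subr_eq0 -[tensor_lift _]/(bl _) -blB.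
by apply/eqP/fglift_tensor_rel/qpi_eq; rewrite qreprK.
Qed.

Lemma tensor_lift_is_linear : linear tensor_lift.
Proof.
move=> a t u; rewrite -[t]qreprK -[u]qreprK -linearP !tensor_lift_qpi.
exact: fglift_is_linear.
Qed.

Lemma tensor_lift_tens x y : tensor_lift (tens x y) = b x y.
Proof. by rewrite tensor_lift_qpi [LHS]liftU scale1r. Qed.

End Lift.

Lemma tensor_ext (P : zmodType) (f g : {additive tensor -> P}) :
  (forall x y, f (tens x y) = g (tens x y)) -> f =1 g.
Proof.
move=> fg t; have [s ->] := tensE t.
by rewrite !raddf_sum; apply: eq_bigr.
Qed.

End Def.

Section Map.
Variables (M M' N N' : lmodType R).
Variables (f : {linear M -> M'}) (g : {linear N -> N'}).

Definition tensor_map : tensor M N -> tensor M' N' :=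
  tensor_lift (fun x y => tens (f x) (g y)).

Let bl y : linear (fun x => tens (f x) (g y)).
Proof. by move=> a x x'; rewrite linearP tensDl tensZl. Qed.

Let br x : linear (fun y => tens (f x) (g y)).
Proof. by move=> a y y'; rewrite linearP tensDr tensZr. Qed.

Lemma tensor_map_tens x y : tensor_map (tens x y) = tens (f x) (g y).
Proof. exact: tensor_lift_tens. Qed.

Lemma tensor_map_is_linear : linear tensor_map.
Proof. exact: tensor_lift_is_linear. Qed.

HB.instance Definition _ :=
  GRing.isLinear.Build R (tensor M N) (tensor M' N') *:%R tensor_map
    tensor_map_is_linear.

End Map.

(* Tensoring with N preserves injections, i.e. is exact. *)
Definition flat (N : lmodType R) : Prop :=
  forall (M M' : lmodType R) (f : {linear M -> M'}), injective f ->
  injective (tensor_map f (idfun : {linear N -> N})).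

End Tensor.

Section ExtensionOfScalars.
Variables (R S : comNzRingType) (phi : {rmorphism R -> S}) (M : lmodType R).

(* M (x)_R S with S acting through the second factor. *)
Definition ext_scal : Type := tensor M (restr phi S^o).

HB.instance Definition _ := GRing.Zmodule.on ext_scal.

Definition ext_scale (s : S) : ext_scal -> ext_scal :=
  tensor_map (idfun : {linear M -> M})
    (@restr_mul R S phi S^o s : {linear restr phi S^o -> restr phi S^o}).

Lemma ext_scale_tens s x (t : S) :
  ext_scale s (tens x (t : restr phi S^o)) = tens x (s * t : restr phi S^o).
Proof. exact: tensor_map_tens. Qed.

Let ext_scale_sum s (l : seq (M * restr phi S^o)) F G :
  ext_scale s (\sum_(p <- l) tens (F p) (G p)) =
  \sum_(p <- l) tens (F p) (restr_mul s (G p)).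
Proof.
rewrite /ext_scale raddf_sum; apply: eq_bigr => p _; exact: tensor_map_tens.
Qed.

Lemma ext_scaleA s t x : ext_scale s (ext_scale t x) = ext_scale (s * t) x.
Proof.
have [l ->] := tensE x; rewrite !ext_scale_sum; apply: eq_bigr => p _.
by rewrite /restr_mul scalerA.
Qed.

Lemma ext_scale1 : left_id 1 ext_scale.
Proof.
move=> x; have [l ->] := tensE x; rewrite ext_scale_sum.
by apply: eq_bigr => p _; rewrite /restr_mul scale1r.
Qed.

Lemma ext_scaleDr : right_distributive ext_scale +%R.
Proof. by move=> s x y; rewrite /ext_scale raddfD. Qed.

Lemma ext_scaleDl x : {morph ext_scale^~ x : s t / s + t}.
Proof.
move=> s t /=; have [l ->] := tensE x.
rewrite !ext_scale_sum -big_split; apply: eq_bigr => p _ /=.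
by rewrite /restr_mul scalerDl tensDr.
Qed.

HB.instance Definition _ := GRing.Zmodule_isLmodule.Build S ext_scal
  ext_scaleA ext_scale1 ext_scaleDr ext_scaleDl.

End ExtensionOfScalars.

Record module_structure (S : comNzRingType) (V : zmodType) := ModuleStructure {
  act :> S -> V -> V;
  actA : forall s t v, act s (act t v) = act (s * t) v;
  act1 : left_id 1 act;
  actDr : right_distributive act +%R;
  actDl : forall v, {morph act^~ v : s t / s + t} }.

(* An alias of V with that S-module structure; it does not inherit other
   structures of V, e.g. those of an R-module. *)
Definition with_structure (S : comNzRingType) (V : zmodType)
  (str : module_structure S V) : Type := V.

Section WithStructure.
Variables (S : comNzRingType) (V : zmodType) (str : module_structure S V).

HB.instance Definition _ := GRing.Zmodule.on (with_structure str).

HB.instance Definition _ :=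
  GRing.Zmodule_isLmodule.Build S (with_structure str)
    (@actA _ _ str) (@act1 _ _ str) (@actDr _ _ str) (@actDl _ _ str).

End WithStructure.

Definition extended_ideal (R S : comNzRingType) (phi : {rmorphism R -> S})
  (I : ideal R) : ideal S := span (phi @` I : set S^o).

(* Main.v *)
Require Import Defs.
From HB Require Import structures.
From mathcomp Require Import all_boot all_algebra.
From mathcomp Require Import boolp classical_sets.

(** The module [S / mR S] is a vector space over the residue field [R / mR],
    and its length [m] is its dimension; lift a basis of it to [s_1, ..., s_m]
    in [S].  The isomorphism is the [R]-linear map
    [(x_1, ..., x_m) |-> sum_i x_i (x) s_i] from [A^m] to [A (x) S]
    ([basis_comb]); once it is known to be bijective ([basis_comb_bij]), the
    [S]-action is transported from [A (x) S] to [A^m].  On [A (x) S], acting by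
    [phi r] is acting by [r], so the transported action restricts to the usual
    one; hence [S]-submodules of [A^m] are [R]-submodules, and [A^m] is Artinian
    over [S] because it is so over [R] ([artinian_ffun]).

    Bijectivity comes from a filtration of [A].  Let [A_k] be the set of
    elements killed by every product of [k] elements of [mR].  As [A] is
    Artinian and [R] is local Noetherian, [A] is the union of the [A_k]
    ([artinian_torsion]).  Both halves go by induction on [k].

    For surjectivity, write [t] in [S] as [sum_i phi (c_i) s_i] plus an element
    of [mR S]; for [a] in [A_(k+1)], the tensor product of [a] with an element
    of [mR S] is a sum of tensors [(x a) (x) u] with [x] in [mR], that is, with
    [x a] in [A_k] ([basis_comb_surj_tens]).

    For injectivity, a vector [x] in the kernel with entries in [A_(k+1)] has
    [r x] in the kernel with entries in [A_k] for all [r] in [mR], so [r x = 0]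
    by induction, and the entries of [x] lie in the submodule [A_1], which is
    killed by [mR].  By flatness [A_1 (x) S] embeds into [A (x) S], so the
    sum already vanishes in [A_1 (x) S]
    ([basis_comb_inj_torsion]).  There the coordinates of [S / mR S] in the
    chosen basis, which are defined modulo [mR], give [R]-linear maps
    [A_1 (x) S -> A_1] that recover the entries of [x]
    ([basis_comb_inj_killed]). *)

Set Implicit Arguments.
Unset Strict Implicit.
Unset Printing Implicit Defensive.

Import GRing.Theory.

Local Open Scope classical_set_scope.
Local Open Scope ring_scope.

(** * Submodules, cyclic submodules and spans of sequences *)

Section SubmoduleTheory.
Variables (R : comNzRingType) (M : lmodType R).
Implicit Types (N : submodule M) (x y : M).

Lemma submod0 N : submod_set N 0. Proof. by case: (submodP N). Qed.

Lemma submodD N x y : submod_set N x -> submod_set N y -> submod_set N (x + y).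
Proof. by move=> Nx Ny; rewrite -[x]scale1r; apply: (submodP N).2. Qed.

Lemma submodZ N (a : R) x : submod_set N x -> submod_set N (a *: x).
Proof. by move=> Nx; rewrite -[_ *: _]addr0; apply: (submodP N).2 (submod0 N). Qed.

Lemma submodB N x y : submod_set N x -> submod_set N y -> submod_set N (x - y).
Proof.
by move=> Nx Ny; apply: submodD => //; rewrite -scaleN1r; apply: submodZ.
Qed.

Lemma submod_sum N n (x : 'I_n -> M) : (forall i, submod_set N (x i)) ->
  submod_set N (\sum_i x i).
Proof.
move=> Nx; apply: (big_ind (submod_set N)) => //; first exact: submod0.
exact: submodD.
Qed.

Lemma cyclic_is_submod x : is_submod [set y | exists r : R, y = r *: x].
Proof.
split; first by exists 0; rewrite scale0r.
by move=> a _ _ [r ->] [s ->]; exists (a * r + s); rewrite scalerDl scalerA.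
Qed.

Definition cyclic_submod x := Submodule (cyclic_is_submod x).

Lemma cyclic_submod_gen x : submod_set (cyclic_submod x) x.
Proof. by exists 1; rewrite scale1r. Qed.

(** The span of the first [i] terms of a sequence, indexed so that increasing
    [i] gives a chain of submodules. *)
Definition lincomb (v : nat -> M) (i : nat) : set M :=
  [set y | exists c : nat -> R, y = \sum_(j < i) c j *: v j].

Lemma lincomb_is_submod v i : is_submod (lincomb v i).
Proof.
split; first by exists (fun=> 0); rewrite big1 // => j _; rewrite scale0r.
move=> a _ _ [c ->] [d ->]; exists (fun j => a * c j + d j).
rewrite scaler_sumr -big_split; apply: eq_bigr => j _ /=.
by rewrite scalerDl scalerA.
Qed.

Definition lincomb_submod v i := Submodule (lincomb_is_submod v i).

Lemma lincomb_incl v i : lincomb v i `<=` lincomb v i.+1.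
Proof.
move=> _ [c ->]; exists (fun j => if (j < i)%N then c j else 0).
rewrite big_ord_recr /= ltnn scale0r addr0.
by apply: eq_bigr => j _; rewrite ltn_ord.
Qed.

Lemma lincomb_last v i : lincomb v i.+1 (v i).
Proof.
exists (fun j => (j == i)%:R); rewrite big_ord_recr /= eqxx scale1r big1 ?add0r //.
by move=> j _; rewrite (ltn_eqF (ltn_ord j)) scale0r.
Qed.

Lemma lincomb_eq v w i : (forall j, (j < i)%N -> v j = w j) ->
  lincomb v i `<=` lincomb w i.
Proof.
by move=> vw _ [c ->]; exists c; apply: eq_bigr => j _; rewrite vw.
Qed.

Lemma lincomb_strict_chain v n : (forall i, (i < n)%N -> ~ lincomb v i (v i)) ->
  strict_chain n (lincomb_submod v).
Proof.
move=> vN i /vN Nvi; split; first exact: lincomb_incl.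
by move/(_ _ (lincomb_last v i)).
Qed.

End SubmoduleTheory.

(** * Maximal and minimal conditions *)

(** A relation without infinite descent has minimal elements: otherwise
    choose a smaller element at each step. *)
Lemma no_descent_minimal (T : Type) (lt : T -> T -> Prop) (P : T -> Prop) (x : T) :
  (forall u : nat -> T, ~ forall i, lt (u i.+1) (u i)) -> P x ->
  exists2 y, P y & forall z, P z -> ~ lt z y.
Proof.
move=> wf Px; apply: contrapT => nomin.
have step y : exists z, P y -> P z /\ lt z y.
  apply: contrapT => noz; apply: nomin; exists y.
    by apply: contrapT => NPy; apply: noz; exists y.
  by move=> z Pz zy; apply: noz; exists z.
have [f fP] := choice step.
have Pf i : P (iter i f x) by elim: i => //= i /fP[].
by apply: (wf (fun i => iter i f x)) => i; have [] := fP _ (Pf i).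
Qed.

Lemma noetherian_maximal (R : comNzRingType) (M : lmodType R)
    (P : submodule M -> Prop) (N : submodule M) :
  noetherian M -> P N ->
  exists2 L, P L & forall K, P K -> L `<=` K -> K = L :> set M.
Proof.
move=> noeM PN.
have [|L PL Lmax] := @no_descent_minimal _ (fun K L : submodule M => L `<` K) P N _ PN.
  move=> u u_asc; have [i|n un] := noeM u; first by have [] := u_asc i.
  by have [_] := u_asc n; rewrite (un n.+1) //; apply.
exists L => // K PK LK; apply/seteqP; split=> // x Kx; apply: contrapT => NLx.
by apply: (Lmax K PK); split=> // /(_ _ Kx).
Qed.

Lemma artinian_minimal (R : comNzRingType) (M : lmodType R)
    (P : submodule M -> Prop) (N : submodule M) :
  artinian M -> P N ->
  exists2 L, P L & forall K, P K -> K `<=` L -> K = L :> set M.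
Proof.
move=> artM PN.
have [|L PL Lmin] := @no_descent_minimal _ (fun K L : submodule M => K `<` L) P N _ PN.
  move=> u u_desc; have [i|n un] := artM u; first by have [] := u_desc i.
  by have [_] := u_desc n; rewrite (un n.+1) //; apply.
exists L => // K PK KL; apply/seteqP; split=> // x Lx; apply: contrapT => NKx.
by apply: (Lmin K PK); split=> // /(_ _ Lx).
Qed.

(** * Modules over a Noetherian local ring *)

Section LocalNoetherian.
Variables (R : comNzRingType) (mR : ideal R).
Hypotheses (noeR : noetherian R^o) (locR : local_ring mR).

(** An ideal that is maximal among the proper ideals containing a nonunit [r]
    is a maximal ideal, hence is [mR]. *)
Lemma local_unit (r : R) : ~ submod_set mR r -> exists s : R, s * r = 1.
Proof.
move=> Nmr; apply: contrapT => Nur.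
have proper_r : cyclic_submod (r : R^o) <> [set: R] :> set R.
  move=> rT; have [s s1] : submod_set (cyclic_submod (r : R^o)) 1 by rewrite rT.
  by apply: Nur; exists s.
have [|J [rJ JT] Jmax] := @noetherian_maximal _ _
  (fun J : ideal R => cyclic_submod (r : R^o) `<=` J /\ J <> [set: R] :> set R)
  (cyclic_submod (r : R^o)) noeR; first by split.
have maxJ : maximal_ideal J.
  split=> // K JK; have [KT|KT] := pselect (K = [set: R] :> set R); first by right.
  left; apply: Jmax => //; split=> //.
  by move=> x /rJ; exact: JK.
by apply: Nmr; rewrite -(locR.2 J maxJ); apply: rJ; exact: cyclic_submod_gen.
Qed.

Lemma local_unit_1B (x : R) : submod_set mR x -> exists s : R, s * (1 - x) = 1.
Proof.
move=> mx; apply: local_unit => m1x; apply: locR.1.1.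
apply/seteqP; split=> // y _.
have m1 : submod_set mR 1 by rewrite -[1](subrK x); apply: submodD.
by rewrite -[y]mulr1; apply: (@submodZ _ R^o).
Qed.

(** A module killed by [mR] is a vector space over [R / mR], and its length is
    the size of a basis.  Choosing [v i] in the [i]-th step of a maximal chain
    but not in the step before gives [n] vectors, none of which is a combination
    of those before it.  They generate, as another vector would extend the chain
    of their spans beyond length [n]; and in a relation, the last coefficient
    outside [mR] would be invertible. *)
Lemma length_basis (M : lmodType R) n :
  (forall x (u : M), submod_set mR x -> x *: u = 0) -> has_length M n ->
  exists v : 'I_n -> M,
    (forall u, exists c : 'I_n -> R, u = \sum_i c i *: v i) /\
    (forall c : 'I_n -> R, \sum_i c i *: v i = 0 -> forall i, submod_set mR (c i)).
Proof.
move=> mM0 [[N Nchain] lenM].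
have pick i : exists x, (i < n)%N -> submod_set (N i.+1) x /\ ~ submod_set (N i) x.
  case: (ltnP i n) => [/Nchain [_ Nsub]|_]; last by exists 0.
  apply: contrapT => nox; apply: Nsub => x Nx; apply: contrapT => NNx.
  by apply: nox; exists x.
have [v vP] := choice pick.
have Nle i j : (i <= j)%N -> (j <= n)%N -> N i `<=` N j.
  elim: j => [|j IHj]; first by rewrite leqn0 => /eqP -> _ x.
  rewrite leq_eqVlt => /orP[/eqP-> _ x //|le_ij] lt_jn x /(IHj le_ij (ltnW lt_jn)).
  have [NN _] := Nchain _ lt_jn; exact: NN.
have vN i : (i <= n)%N -> lincomb v i `<=` N i.
  move=> le_in _ [c ->]; apply: submod_sum => j; apply: submodZ.
  have lt_jn : (j < n)%N by exact: leq_trans (ltn_ord j) le_in.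
  exact: Nle (ltn_ord j) le_in _ (vP _ lt_jn).1.
have vNlin i : (i < n)%N -> ~ lincomb v i (v i).
  by move=> lt_in /(vN _ (ltnW lt_in)); have [] := vP _ lt_in.
exists (fun i => v i); split=> [u|].
  suff [c ->] : lincomb v n u by exists (fun i => c i).
  apply: contrapT => Nu; pose w i := if (i < n)%N then v i else u.
  suff /lenM : strict_chain n.+1 (lincomb_submod w) by rewrite ltnn.
  apply: lincomb_strict_chain => i; rewrite ltnS => le_in lin_i.
  have {}lin_i : lincomb v i (w i).
    apply: lincomb_eq lin_i => j lt_ji.
    by rewrite /w (leq_trans lt_ji le_in).
  move: lin_i; rewrite /w; case: ltnP => [/vNlin//|le_ni].
  by have -> : i = n by apply/eqP; rewrite eqn_leq le_in.
suff indep k : (k <= n)%N -> forall c : nat -> R, \sum_(j < k) c j *: v j = 0 ->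
    forall j, (j < k)%N -> submod_set mR (c j).
  move=> c c0 i; have := indep n (leqnn n)
    (fun j => if insub j is Some i then c i else 0).
  move/(_ _ i (ltn_ord i)); rewrite valK; apply; rewrite -[RHS]c0.
  by apply: eq_bigr => j _; rewrite valK.
elim: k => // k IHk lt_kn c; rewrite big_ord_recr /= => ck0.
have mck : submod_set mR (c k).
  apply: contrapT => /local_unit[s sck]; apply: (vNlin k lt_kn).
  exists (fun j => - s * c j); rewrite -[LHS]scale1r -sck -scalerA.
  have -> : c k *: v k = - \sum_(j < k) c j *: v j.
    by apply/eqP; rewrite -addr_eq0 addrC ck0.
  rewrite scalerN -scaleNr scaler_sumr; apply: eq_bigr => j _.
  by rewrite scalerA.
move=> j; rewrite ltnS leq_eqVlt => /orP[/eqP-> //|].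
by apply: (IHk (ltnW lt_kn)); move: ck0; rewrite mM0 // addr0.
Qed.

(** The elements killed by all products of [k] elements of [mR], that is, by
    the [k]-th power of [mR]; the recursive form serves inductions on [k]. *)
Fixpoint torsion_level (A : lmodType R) k (a : A) : Prop :=
  if k is k'.+1 then forall x, submod_set mR x -> torsion_level k' (x *: a) else a = 0.

Lemma torsion_level_is_submod (A : lmodType R) k :
  is_submod (@torsion_level A k).
Proof.
elim: k => [|k [IH0 IH]].
  by split=> // a u v /= -> ->; rewrite scaler0 addr0.
split=> [x mx|a u v tu tv x mx] /=; first by rewrite scaler0.
by rewrite scalerDr scalerA mulrC -scalerA; apply: IH; [exact: tu|exact: tv].
Qed.

Definition torsion_submod A k := Submodule (@torsion_level_is_submod A k).

Lemma torsion_levelS (A : lmodType R) k (a : A) :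
  torsion_level k a -> torsion_level k.+1 a.
Proof.
elim: k a => [a -> x _|k IHk a ta x mx]; first by rewrite scaler0.
by apply: IHk; exact: ta.
Qed.

(** The ideals [I_k] of those [r] such that [r a] has level [k] increase, so
    they stabilize at some [n].  If [a] did not have level [n], take a minimal
    submodule [R b] among those with [b] a multiple of [a] not of level [n].
    Since [I_(n+1) = I_n], the element [b] is not of level [n + 1], so [x b] is
    not of level [n] for some [x] in [mR]; by minimality [b] is a multiple of
    [x b], and inverting [1 - s x] gives [b = 0]. *)
Lemma artinian_torsion (A : lmodType R) (a : A) :
  artinian A -> exists k, torsion_level k a.
Proof.
move=> artA.
have idealP k : is_submod [set r : R^o | torsion_level k (r *: a)].
  split=> [|r s t ts tt]; rewrite /mkset.
    by rewrite scale0r; exact: (submod0 (torsion_submod A k)).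
  by rewrite scalerDl -scalerA; apply: (torsion_level_is_submod A k).2.
have [|n stab] := noeR (N := fun k => Submodule (idealP k)).
  by move=> k r; exact: torsion_levelS.
exists n; apply: contrapT => Nta.
pose P (N : submodule A) := exists r : R,
  ~ torsion_level n (r *: a) /\ N = cyclic_submod (r *: a).
have [|N [r [Nra ->]] Nmin] := @artinian_minimal _ _ P (cyclic_submod a) artA.
  by exists 1; rewrite scale1r.
have [x mx Nxra] : exists2 x, submod_set mR x & ~ torsion_level n (x *: (r *: a)).
  apply: contrapT => nox; apply: Nra.
  have : torsion_level n.+1 (r *: a).
    by move=> x mx; apply: contrapT => Nx; apply: nox; exists x.
  have /seteqP[stab_n _] := stab n.+1 (leqnSn n); exact: (stab_n r).
have [s] : submod_set (cyclic_submod (x *: (r *: a))) (r *: a).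
  rewrite Nmin; first exact: cyclic_submod_gen.
    by exists (x * r); rewrite -scalerA; split.
  by move=> _ [s ->]; exists (s * x); rewrite !scalerA.
rewrite scalerA => /eqP; rewrite -subr_eq0 -{1}[r *: a]scale1r -scalerBl => /eqP ra0.
have [t t1] := @local_unit_1B (s * x) (@submodZ _ R^o mR s x mx).
apply: Nra; rewrite -[r *: a]scale1r -t1 -scalerA ra0 scaler0.
exact: (submod0 (torsion_submod A n)).
Qed.

End LocalNoetherian.

(** For a submodule [L] of [A^n] and an index [j], let [lead L j] be the
    submodule of the [j]-th entries of those vectors of [L] whose earlier
    entries vanish.  These [n] submodules of [A] detect equality of nested
    submodules [L], as in the theory of leading terms, and each of them
    stabilizes along a descending chain. *)
Lemma artinian_ffun (R : comNzRingType) (A : lmodType R) n :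
  artinian A -> artinian {ffun 'I_n -> A}.
Proof.
move=> artA N Ndesc.
have Nle i j : (i <= j)%N -> N j `<=` N i.
  move=> /subnK <-; elim: (j - i)%N => // k IHk x; rewrite addSn => /Ndesc; exact: IHk.
pose lead (L : submodule {ffun 'I_n -> A}) (j : 'I_n) : set A :=
  [set a | exists x,
    [/\ submod_set L x, forall i : 'I_n, (i < j)%N -> x i = 0 & x j = a]].
have leadP L j : is_submod (lead L j).
  split.
    by exists 0; split=> [|i _|]; rewrite ?ffunE //; exact: submod0.
  move=> r _ _ [x [Lx x0 <-]] [y [Ly y0 <-]].
  exists (r *: x + y); split; first exact: (submodP L).2.
    by move=> i lt_ij; rewrite !ffunE x0 // y0 // scaler0 addr0.
  by rewrite !ffunE.
have stab j : exists k, forall i, (k <= i)%N -> lead (N i) j = lead (N k) j.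
  apply: (artA (fun i => Submodule (leadP (N i) j))) => i a [x [Nx x0 xj]].
  by exists x; split=> //; exact: Ndesc.
have [k kP] := choice stab.
pose n0 := (\max_j k j)%N.
exists n0 => i le_n0i; apply/seteqP; split; first exact: Nle.
move=> x Nx.
(* Approximate x by elements of N i, correcting one entry at a time. *)
suff /(_ n (leqnn n)) [y Niy xy] : forall j, (j <= n)%N ->
    exists2 y, submod_set (N i) y & forall l : 'I_n, (l < j)%N -> (x - y) l = 0.
  suff -> : x = y by [].
  by apply/eqP; rewrite -subr_eq0; apply/eqP/ffunP => l; rewrite xy ?ffunE.
elim=> [|j IHj] lt_jn; first by exists 0 => //; exact: submod0.
have [y Niy xy] := IHj (ltnW lt_jn).
pose l := Ordinal lt_jn.
have le_kl : (k l <= n0)%N by exact: leq_bigmax.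
have : lead (N n0) l ((x - y) l).
  by exists (x - y); split=> //; apply: submodB => //; exact: Nle Niy.
rewrite kP // -(kP l i) ?(leq_trans le_kl) // => -[z [Niz z0 zl]].
exists (y + z); first exact: submodD.
move=> p; rewrite opprD addrA ffunE [(- z) p]ffunE ltnS leq_eqVlt => /orP[/eqP pj|lt_pj].
  by have -> : p = l by [exact: val_inj]; rewrite zl subrr.
by rewrite xy // z0 // subrr.
Qed.

(** * Submodules as modules in their own right *)

Section SubmoduleType.
Variables (R : comNzRingType) (M : lmodType R) (N : submodule M).

Lemma submod_pred_scale : GRing.scaler_closed (submod_pred N).
Proof. by move=> a u /submod_predP Nu; apply/submod_predP/submodZ. Qed.

HB.instance Definition _ :=
  GRing.isScaleClosed.Build R M (submod_pred N) submod_pred_scale.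

Definition submod_type : Type := {x : M | x \in submod_pred N}.

HB.instance Definition _ := SubChoice.on submod_type.
HB.instance Definition _ := [SubChoice_isSubLmodule of submod_type by <:].

Definition submod_val : {linear submod_type -> M} := \val.

Lemma submod_val_inj : injective submod_val.
Proof. exact: val_inj. Qed.

Lemma submod_valP x : submod_set N x -> exists y, submod_val y = x.
Proof. by move=> /submod_predP Nx; exists (exist _ x Nx). Qed.

End SubmoduleType.

(** * Linear combinations in a tensor product *)

Section TensorBilinear.
Variables (R : comNzRingType) (M N : lmodType R).

Lemma tens_sumr n (x : M) (y : 'I_n -> N) :
  tens x (\sum_i y i) = \sum_i tens x (y i).
Proof.
apply: (big_ind2 (fun u v => tens x u = v)) => //.
  by rewrite -(scale0r 0) tensZr scale0r.
by move=> u _ v _ <- <-; exact: tensDr.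
Qed.

Lemma tens0l (y : N) : tens (0 : M) y = 0.
Proof. by rewrite -(scale0r 0) tensZl scale0r. Qed.

End TensorBilinear.

(** * Lifting a basis of the closed fiber *)

Section FiberBasis.
Variables (R S : comNzRingType) (mR : ideal R) (phi : {rmorphism R -> S}).
Variables (n : nat) (s : 'I_n -> S).

Local Notation S' := (restr phi S^o).
Local Notation tensS a t := (@tens R _ (restr phi S^o) a t).
Local Notation mS := (extended_ideal phi mR).

(** [fiber_generating] and [fiber_independent] together say that the classes
    of the [s i] form a basis of [S / mR S] over [R / mR], phrased in [S] so
    that no quotient is involved. *)
Definition fiber_generating : Prop :=
  forall t : S, exists c : 'I_n -> R,
    submod_set mS (t - \sum_i phi (c i) * s i).

Definition fiber_independent : Prop :=
  forall c : 'I_n -> R, submod_set mS (\sum_i phi (c i) * s i) ->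
  forall i, submod_set mR (c i).

Definition basis_comb (A : lmodType R) (x : {ffun 'I_n -> A}) : tensor A S' :=
  \sum_i tensS (x i) (s i).

Lemma basis_comb_is_linear (A : lmodType R) : linear (@basis_comb A).
Proof.
move=> r x y; rewrite /basis_comb scaler_sumr -big_split; apply: eq_bigr => i _.
by rewrite !ffunE tensDl tensZl.
Qed.

HB.instance Definition _ (A : lmodType R) :=
  GRing.isLinear.Build R {ffun 'I_n -> A} (tensor A S') *:%R (@basis_comb A)
    (@basis_comb_is_linear A).

Lemma basis_comb_image (A : lmodType R) :
  is_submod [set y | exists x, basis_comb (A := A) x = y].
Proof.
split; first by exists 0; rewrite linear0.
by move=> r _ _ [x <-] [y <-]; exists (r *: x + y); rewrite linearP.
Qed.

Lemma basis_comb_tens (A : lmodType R) (c : 'I_n -> R) (a : A) :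
  basis_comb [ffun i => c i *: a] = tensS a (\sum_i phi (c i) * s i).
Proof.
rewrite tens_sumr; apply: eq_bigr => i _.
by rewrite ffunE tensZl -tensZr.
Qed.

(** Modulo the image, [a (x) t] may be replaced by [a (x) t'] with [t'] in
    [mR S], and [a (x) phi x w = (x a) (x) w] lowers the level of [a]. *)
Lemma basis_comb_surj_tens (A : lmodType R) k (a : A) (t : S) :
  fiber_generating -> torsion_level mR k a ->
  exists x, basis_comb x = tensS a t.
Proof.
move=> gen; elim: k a t => [|k IHk] a t.
  by move=> ->; exists 0; rewrite linear0 tens0l.
move=> ta; pose im := Submodule (basis_comb_image A).
(* The factor w makes the condition on u stable under multiplication by S,
   so that it may be checked on the generators of the ideal mR S. *)
have im_sum t' : submod_set mS t' -> forall w : S, submod_set im (tensS a (t' * w)).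
  have idealP : is_submod
      [set u : S^o | forall w : S, submod_set im (tensS a (u * w))].
    split=> [w|r u u' imu imu' w].
      by rewrite mul0r -(scale0r (0 : S')) tensZr scale0r; exact: (submod0 im).
    rewrite mulrDl [tens _ _]tensDr; apply: (@submodD _ _ im); last exact: imu'.
    by rewrite [r *: u]mulrC -mulrA; exact: imu.
  apply: (@span_min _ _ _ (Submodule idealP)) => _ [x mx <-] w.
  have -> : tensS a (phi x * w) = tensS (x *: a) w.
    by rewrite tensZl -tensZr.
  by apply: IHk; exact: ta.
have [c mSt] := gen t.
rewrite -[t](subrK (\sum_i phi (c i) * s i)) [tens _ _]tensDr.
apply: (@submodD _ _ im); last by exists [ffun i => c i *: a]; exact: basis_comb_tens.
by rewrite -[X in tensS a X]mulr1; exact: im_sum.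
Qed.

Lemma basis_comb_surj (A : lmodType R) :
  fiber_generating -> (forall a : A, exists k, torsion_level mR k a) ->
  forall y, exists x, @basis_comb A x = y.
Proof.
move=> gen tors y; have [l ->] := tensE y.
pose im := Submodule (basis_comb_image A).
apply: (big_ind (submod_set im)); [exact: submod0|exact: submodD|].
by move=> [a t] _; have [k ta] := tors a; exact: basis_comb_surj_tens ta.
Qed.

(** On a module killed by [mR], the coordinates of [S / mR S], though only
    defined modulo [mR], act by well-defined scalars; this gives linear maps
    [A (x) S -> A] that read off the entries of [x]. *)
Lemma basis_comb_inj_killed (A : lmodType R) (x : {ffun 'I_n -> A}) :
  fiber_generating -> fiber_independent ->
  (forall r (a : A), submod_set mR r -> r *: a = 0) ->
  basis_comb x = 0 -> x = 0.
Proof.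
move=> gen indep mA0 x0; have [c cP] := choice gen.
(* Coordinates are unique modulo mR, which annihilates A. *)
have coordE t d : submod_set mS (t - \sum_i phi (d i) * s i) ->
    forall i (a : A), c t i *: a = d i *: a.
  move=> dP i a; apply/eqP; rewrite -subr_eq0 -scalerBl; apply/eqP/mA0.
  apply: (indep (fun i => c t i - d i)).
  have -> : \sum_i phi (c t i - d i) * s i =
      (t - \sum_i phi (d i) * s i) - (t - \sum_i phi (c t i) * s i).
    rewrite opprB [RHS]addrC addrA subrK -sumrB.
    by apply: eq_bigr => j _; rewrite rmorphB mulrBl.
  exact: submodB.
have coord_lin i (a : A) : linear (fun t : S' => c t i *: a).
  move=> r t u; rewrite scalerA -scalerDl.
  apply: (coordE _ (fun i => r * c t i + c u i)).
  have -> : (r *: t + u : S') - \sum_i phi (r * c t i + c u i) * s i =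
     phi r *: (t - \sum_i phi (c t i) * s i : S^o) + (u - \sum_i phi (c u i) * s i).
    rewrite [_ *: (_ - _)]mulrBr mulr_sumr addrACA -opprD -big_split.
    congr (_ - _); apply: eq_bigr => j _.
    by rewrite rmorphD rmorphM mulrDl mulrA.
  by apply: (submodP mS).2; exact: cP.
have coord_linl i (t : S') : linear (fun a : A => c t i *: a).
  by move=> r a b; rewrite scalerDr !scalerA mulrC.
apply/ffunP => i; rewrite ffunE.
pose coord : tensor A S' -> A := tensor_lift (fun a (t : S') => c t i *: a).
have coordL : linear coord by exact: tensor_lift_is_linear.
pose h : {linear tensor A S' -> A} :=
  HB.pack coord (GRing.isLinear.Build _ _ _ _ coord coordL).
have h_basis j : h (tensS (x j) (s j)) = (j == i)%:R *: x j.
  rewrite [LHS]tensor_lift_tens // (coordE _ (fun l => (l == j)%:R)) ?[i == j]eq_sym //.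
  rewrite (bigD1 j) //= big1 ?addr0 ?eqxx ?rmorph1 ?mul1r ?subrr.
    exact: (submod0 mS).
  by move=> l /negPf->; rewrite rmorph0 mul0r.
have <- : h (basis_comb x) = x i; last by rewrite x0 linear0.
rewrite linear_sum (bigD1 i) //= [X in X + _]h_basis eqxx scale1r big1 ?addr0 // => j ji.
by rewrite [LHS]h_basis (negPf ji) scale0r.
Qed.

(** Multiplying by elements of [mR] lowers the level, so by induction the
    entries of [x] are killed by [mR]; flatness then allows replacing [A] by
    its submodule of elements killed by [mR]. *)
Lemma basis_comb_inj_torsion (A : lmodType R) k (x : {ffun 'I_n -> A}) :
  flat S' -> fiber_generating -> fiber_independent ->
  (forall i, torsion_level mR k (x i)) -> basis_comb x = 0 -> x = 0.
Proof.
move=> flatS gen indep; elim: k x => [|k IHk] x tx x0.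
  by apply/ffunP => i; rewrite ffunE; exact: tx.
pose N := torsion_submod mR A 1.
have socx i : submod_set N (x i).
  move=> r mr; have /ffunP/(_ i) : r *: x = 0.
    apply: IHk => [j|]; first by rewrite ffunE; exact: tx.
    by rewrite linearZ /= x0 scaler0.
  by rewrite !ffunE.
have [y yP] := choice (fun i => submod_valP (socx i)).
have : [ffun i => y i] = 0 :> {ffun 'I_n -> submod_type N}.
  apply: basis_comb_inj_killed => // [r a mr|].
    apply: (@submod_val_inj _ _ N); rewrite linearZ linear0.
    by have /submod_predP := valP a; exact.
  (* The vector y maps to x under the inclusion of N, tensored with S. *)
  apply: (flatS _ _ _ (@submod_val_inj _ _ N)).
  rewrite linear0 linear_sum -[RHS]x0; apply: eq_bigr => i _ /=.
  by rewrite [LHS]tensor_map_tens ffunE yP.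
move=> /ffunP y0; apply/ffunP => i; have := y0 i.
by rewrite !ffunE -yP => ->; rewrite linear0.
Qed.

Lemma basis_comb_bij (A : lmodType R) :
  flat S' -> fiber_generating -> fiber_independent ->
  (forall a : A, exists k, torsion_level mR k a) -> bijective (@basis_comb A).
Proof.
move=> flatS gen indep tors; have [g gK] := choice (basis_comb_surj gen tors).
exists g => // x; apply/eqP; rewrite -subr_eq0; apply/eqP.
have [k kP] := choice (fun i => tors ((g (basis_comb x) - x) i)).
apply: (@basis_comb_inj_torsion A (\max_i k i)%N) => // [i|].
  have := kP i; have := leq_bigmax (F := k) i; move/subnK => <-.
  by elim: (_ - _)%N => // l IHl ti; rewrite addSn; apply/torsion_levelS/IHl.
by rewrite linearB /= gK subrr.
Qed.

End FiberBasis.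

Lemma fiber_basis (R S : comNzRingType) (mR : ideal R) (phi : {rmorphism R -> S}) n :
  noetherian R^o -> local_ring mR ->
  has_length (restr phi (quotmod (extended_ideal phi mR))) n ->
  exists s : 'I_n -> S, fiber_generating mR phi s /\ fiber_independent mR phi s.
Proof.
move=> noeR locR lenF; set mS := extended_ideal phi mR in lenF *.
have killF (x : R) (u : restr phi (quotmod mS)) : submod_set mR x -> x *: u = 0.
  move=> mx; rewrite -(@qreprK S S^o mS u) [LHS]qscale_qpi; apply/qpi_eq0.
  rewrite [_ *: _]mulrC; apply: (@submodZ S S^o mS).
  by apply: Defs.sub_span; exists x.
have [v [gen indep]] := length_basis noeR locR killF lenF.
have combE (c : 'I_n -> R) : qpi mS (\sum_i phi (c i) * qrepr (v i)) =
    \sum_i c i *: v i.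
  rewrite linear_sum; apply: eq_bigr => i _ /=.
  by rewrite [LHS](linearZ _ (qrepr (v i))) /= qreprK.
exists (fun i => qrepr (v i)); split.
  move=> t; have [c tE] := gen (qpi mS t); exists c.
  by apply/qpi_eq; rewrite combE.
by move=> c /qpi_eq0; rewrite combE; exact: indep.
Qed.

(** * Transport of structure and the theorem *)

Section Transport.
Variables (S : comNzRingType) (V : zmodType) (W : lmodType S).
Variables (f : {additive V -> W}) (g : W -> V).
Hypotheses (fK : cancel f g) (gK : cancel g f).

Let actA a b v : g (a *: f (g (b *: f v))) = g ((a * b) *: f v).
Proof. by rewrite gK scalerA. Qed.

Let act1 v : g (1 *: f v) = v.
Proof. by rewrite scale1r fK. Qed.

Let actDr a u v : g (a *: f (u + v)) = g (a *: f u) + g (a *: f v).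
Proof. by apply: (can_inj fK); rewrite !raddfD !gK. Qed.

Let actDl v a b : g ((a + b) *: f v) = g (a *: f v) + g (b *: f v).
Proof. by apply: (can_inj fK); rewrite raddfD !gK scalerDl. Qed.

Definition transport_structure : module_structure S V :=
  ModuleStructure actA act1 actDr actDl.

(** The map [g], with its codomain relabelled so that it can be declared
    linear for the transported action. *)
Definition transport_map : W -> with_structure transport_structure := g.

Lemma transport_map_is_linear : linear transport_map.
Proof.
move=> a x y; apply: (can_inj fK); rewrite [RHS]raddfD !gK.
by congr (_ + _); rewrite [X in f X](_ : _ = g (a *: f (g x))) // !gK.
Qed.

HB.instance Definition _ :=
  GRing.isLinear.Build S W (with_structure transport_structure) *:%R
    transport_map transport_map_is_linear.

End Transport.

Theorem theorem1p3 (R S : comNzRingType) (mR : ideal R) (nS : ideal S)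
    (phi : {rmorphism R -> S}) (m : nat) (A : lmodType R) :
  noetherian R^o -> noetherian S^o ->
  local_ring mR -> local_ring nS ->
  (* phi is local and flat *)
  phi @` mR `<=` nS ->
  flat (restr phi S^o) ->
  has_length (restr phi (quotmod (extended_ideal phi mR))) m ->
  artinian A ->
  exists str : module_structure S {ffun 'I_m -> A},
    [/\ artinian (with_structure str),
        exists f : {linear ext_scal phi A -> with_structure str}, bijective f
      & forall (r : R) (x : {ffun 'I_m -> A}), str (phi r) x = r *: x].
Proof.
move=> noeR _ locR _ _ flatS lenF artA.
have [s [gen indep]] := fiber_basis noeR locR lenF.
have tors (a : A) : exists k, torsion_level mR k a by exact: artinian_torsion artA.
have [g fK gK] := basis_comb_bij flatS gen indep tors.
pose f : {additive {ffun 'I_m -> A} -> ext_scal phi A} := basis_comb phi s (A := A).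
pose str := transport_structure (f := f) fK gK.
have strE (r : R) (x : {ffun 'I_m -> A}) : str (phi r) x = r *: x.
  rewrite /= -[RHS]fK linearZ /=; congr g.
  rewrite raddf_sum scaler_sumr; apply: eq_bigr => i _.
  by rewrite [LHS]tensor_map_tens -tensZr.
exists str; split=> //; last first.
  exists (transport_map (f := f) fK gK).
  by exists f.
move=> N Ndesc.
have NR i : is_submod (submod_set (N i) : set {ffun 'I_m -> A}).
  split; first exact: (submod0 (N i)).
  move=> r x y Nx Ny; rewrite -strE; exact: (submodP (N i)).2.
exact: (artinian_ffun artA (N := fun i => Submodule (NR i))).
Qed.
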